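(* There exist absolute constants $c,c'>0$ such that the following holds for any prompt $x\in\mathcal X$, any comparator policy $\pi^\star$, any $\beta>0$ and $\varepsilon_{\mathtt{RM}}^2(x)\in(0,1]$. If $N\ge c\cdot\frac{R_{\max}}{\beta}\log\Big(\frac{R_{\max}}{\beta\cdot\varepsilon_{\mathtt{RM}}(x)}\Big)$, then the output distribution $\hat\pi_{\mathtt{Pes}}$ of the algorithm InferenceTimePessimism with parameters $(N,\beta)$ satisfies $$J(\pi^\star;x)-J(\hat\pi_{\mathtt{Pes}};x)\le c'\left(\sqrt{\mathcal C^{\pi^\star}(x)\cdot\varepsilon_{\mathtt{RM}}^2(x)}+\beta\cdot\mathcal C^{\pi^\star}(x)+\beta^{-1}\cdot\varepsilon_{\mathtt{RM}}^2(x)\right).$$ Moreover, setting $\beta\asymp\sqrt{\varepsilon_{\mathtt{RM}}^2(x)/\mathcal C^{\pi^\star}(x)}$ (equality up to absolute constant factors), as long as $N\ge\tilde\Omega\Big(\sqrt{\frac{R_{\max}^2\cdot\mathcal C^{\pi^\star}(x)}{\varepsilon_{\mathtt{RM}}^2(x)}}\Big)$, where $\tilde\Omega$ hides an absolute constant and a factor polylogarithmic in $R_{\max}$, $\mathcal C^{\pi^\star}(x)$ and $1/\varepsilon_{\mathtt{RM}}(x)$, one has $$J(\pi^\star;x)-J(\hat\pi_{\mathtt{Pes}};x)\le c''\sqrt{\mathcal C^{\pi^\star}(x)\cdot\varepsilon_{\mathtt{RM}}^2(x)}$$ for an absolute constant $c''$.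
   Context: $\mathcal X$ is a set of prompts and $\mathcal Y$ a discrete set of responses. A policy is a map $\pi:\mathcal X\to\Delta(\mathcal Y)$; $\pi_{\mathsf{ref}}$ is a fixed base policy. The true reward $r^\star$ and reward model $\hat r$ are functions $\mathcal X\times\mathcal Y\to[0,R_{\max}]$, $R_{\max}\ge1$. Write $J(\pi;x)=\mathbb E_{y\sim\pi(\cdot\mid x)}[r^\star(x,y)]$, $\varepsilon_{\mathtt{RM}}^2(x)=\mathbb E_{y\sim\pi_{\mathsf{ref}}(\cdot\mid x)}[(\hat r(x,y)-r^\star(x,y))^2]$ with $\varepsilon_{\mathtt{RM}}(x)\ge 0$ its square root, $\mathcal C^{\pi}(x)=\mathbb E_{y\sim\pi(\cdot\mid x)}\big[\frac{\pi(y\mid x)}{\pi_{\mathsf{ref}}(y\mid x)}\big]$, and $\mathsf{relu}(z)=\max\{z,0\}$. Algorithm InferenceTimePessimism (inputs: $x$, $\pi_{\mathsf{ref}}$, $\hat r$, integer $N\ge1$, $\beta>0$): (i) Draw $y_1,\dots,y_N$ i.i.d. from $\pi_{\mathsf{ref}}(\cdot\mid x)$ and let $\hat\lambda(x)$ be the (unique) real number with $\frac1N\sum_{i=1}^N\mathsf{relu}\big(\beta^{-1}(\hat r(x,y_i)-\hat\lambda(x))\big)=1$. (ii) Set $M=\frac{R_{\max}-\hat\lambda(x)}{\beta}$ and $w(y\mid x)=\mathsf{relu}\big(\beta^{-1}(\hat r(x,y)-\hat\lambda(x))\big)$. (iii) Rejection sampling: draw fresh $y_1,\dots,y_{N+1}$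 i.i.d. from $\pi_{\mathsf{ref}}(\cdot\mid x)$; for $i=1,\dots,N$ in order, sample independently $\xi_i\sim\mathrm{Bernoulli}\big(\min\{w(y_i\mid x)/M,1\}\big)$ and, if $\xi_i=1$, return $y_i$ and stop. If no $y_i$ with $i\le N$ is accepted, return $y_{N+1}$. $\hat\pi_{\mathtt{Pes}}(\cdot\mid x)$ is the distribution of the returned response over all the randomness of the algorithm. *)

(* Defs.v *)
From HB Require Import structures.
From mathcomp Require Import all_boot all_order all_algebra.
From mathcomp Require Import all_classical all_reals all_analysis.

Set Implicit Arguments.
Unset Strict Implicit.
Unset Printing Implicit Defensive.

Import Order.TTheory GRing.Theory Num.Theory.
Local Open Scope classical_set_scope.
Local Open Scope ring_scope.

Section esum_complements.
Local Open Scope ereal_scope.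
Context {R : realType}.

Lemma esum_exchange (S T : choiceType) (f : S -> T -> \bar R) :
  (forall s t, 0 <= f s t) ->
  \esum_(s in [set: S]) \esum_(t in [set: T]) f s t =
  \esum_(t in [set: T]) \esum_(s in [set: S]) f s t.
Proof.
move=> f0; rewrite !esum_esum//.
rewrite (@reindex_esum _ _ _ ([set: T] `*`` fun=> [set: S])
  ([set: S] `*`` fun=> [set: T]) (fun u => (u.2, u.1)))//.
by split=> [[a b] []//|[a b] [c d] _ _ [-> ->]//|[a b] _]; exists (b, a).
Qed.

Lemma esumZl (T : choiceType) (c : R) (f : T -> \bar R) : (0 <= c)%R ->
  (forall t, 0 <= f t) ->
  \esum_(t in [set: T]) (c%:E * f t) = c%:E * \esum_(t in [set: T]) f t.
Proof.
have le (d : R) (g : T -> \bar R) : (0 <= d)%R -> (forall t, 0 <= g t) ->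
    \esum_(t in [set: T]) (d%:E * g t) <= d%:E * \esum_(t in [set: T]) g t.
  move=> d0 g0; apply: ge_ereal_sup => _ [X [finX XT] <-].
  rewrite -ge0_mule_fsumr//; apply: lee_wpmul2l; first by rewrite lee_fin.
  by apply: (@esum_ge _ _ _ g); exists X.
move=> c0 f0; apply/eqP; rewrite eq_le le//=.
have [->|cn0] := eqVneq c 0%R.
  by rewrite mul0e; apply: esum_ge0 => t _; rewrite mul0e.
have cf0 t : 0 <= c%:E * f t by rewrite mule_ge0// lee_fin.
have := le c^-1%R (fun t => c%:E * f t); rewrite invr_ge0 => /(_ c0 cf0).
under eq_esum do rewrite muleA -EFinM mulVf// mul1e.
move=> /(lee_wpmul2l (_ : 0 <= c%:E)); rewrite lee_fin => /(_ c0).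
by rewrite muleA -EFinM divff// mul1e.
Qed.

End esum_complements.

Section distributions.
Context {R : realType}.

Record distr (T : choiceType) := Distr {
  pmf :> T -> R;
  pmf_ge0 : forall t, 0 <= pmf t;
  pmf_sum1 : (\esum_(t in [set: T]) (pmf t)%:E = 1)%E }.

Lemma pmf_le1 (T : choiceType) (p : distr T) (t : T) : p t <= 1.
Proof.
rewrite -lee_fin -(pmf_sum1 p); apply: esum_ge; exists [set t] => //.
by rewrite fsbig_set1.
Qed.

Section ret.
Context {T : choiceType} (t0 : T).
Let ret_fun (t : T) : R := (t == t0)%:R.

Let ret_ge0 t : 0 <= ret_fun t. Proof. exact: ler0n. Qed.

Let ret_sum1 : (\esum_(t in [set: T]) (ret_fun t)%:E = 1)%E.
Proof.
rewrite (esumID [set t0]) => [|t _]; last by rewrite lee_fin.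
rewrite setTI esum_set1 ?lee_fin// {1}/ret_fun eqxx setTI esum1 ?adde0//.
by move=> t /= /eqP/negPf tt0; rewrite /ret_fun tt0.
Qed.

Definition ret : distr T := Distr ret_ge0 ret_sum1.
End ret.

Section bind.
Context {S T : choiceType} (p : distr S) (k : S -> distr T).
Let bind_fun (t : T) : R := fine (\esum_(s in [set: S]) (p s * k s t)%:E).

Let pk_ge0 s t : (0 <= (p s * k s t)%:E)%E.
Proof. by rewrite lee_fin mulr_ge0 ?pmf_ge0. Qed.

Lemma bindE t :
  (bind_fun t)%:E = (\esum_(s in [set: S]) (p s * k s t)%:E)%E.
Proof.
rewrite fineK// ge0_fin_numE ?esum_ge0//.
apply: (@le_lt_trans _ _ 1%E); last exact: ltry.
rewrite -(pmf_sum1 p); apply: le_esum => s _.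
by rewrite lee_fin ler_piMr ?pmf_ge0 ?pmf_le1.
Qed.

Let bind_ge0 t : 0 <= bind_fun t.
Proof. by rewrite -lee_fin bindE esum_ge0. Qed.

Let bind_sum1 : (\esum_(t in [set: T]) (bind_fun t)%:E = 1)%E.
Proof.
under eq_esum do rewrite bindE.
rewrite esum_exchange// -(pmf_sum1 p); apply: eq_esum => s _.
under eq_esum do rewrite EFinM.
by rewrite esumZl ?pmf_sum1 ?mule1 ?pmf_ge0// => t; rewrite lee_fin pmf_ge0.
Qed.

Definition bind : distr T := Distr bind_ge0 bind_sum1.
End bind.

Section coin.
Context (p : R) (p01 : 0 <= p <= 1).

Let coin_ge0 b : 0 <= bernoulli_pmf p b.
Proof. exact: bernoulli_pmf_ge0. Qed.

Let coin_sum1 : (\esum_(b in [set: bool]) (bernoulli_pmf p b)%:E = 1)%E.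
Proof.
rewrite -(bernoulli_pmf1 p) -esum_fset//; last by move=> b _; rewrite lee_fin.
exact: finite_finset.
Qed.

Definition coin : distr bool := Distr coin_ge0 coin_sum1.
End coin.

(* Total in p, with the convention of bernoulli_prob outside [0, 1]. *)
Definition bernoulli_distr (p : R) : distr bool :=
  match boolP (0 <= p <= 1) with
  | AltTrue p01 => coin p01
  | AltFalse _ => ret false
  end.

Fixpoint iid {T : choiceType} (n : nat) (p : distr T) : distr (seq T) :=
  if n is n'.+1 then bind p (fun y => bind (iid n' p) (fun s => ret (y :: s)))
  else ret [::].

(* The expectation of a nonnegative function: esum is the supremum of the
   finite partial sums, hence not meaningful for functions of varying sign. *)
Definition expect {T : choiceType} (p : distr T) (f : T -> \bar R) : \bar R :=
  (\esum_(t in [set: T]) ((p t)%:E * f t))%E.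

End distributions.
Arguments distr R T : clear implicits.

Definition policy (R : realType) (X : Type) (Y : choiceType) := X -> distr R Y.

Section alignment.
Context {R : realType} {X : Type} {Y : choiceType}.
Implicit Types (pi pref : policy R X Y) (r rhat : X -> Y -> R).

Definition bounded_reward (Rmax : R) r := forall x y, 0 <= r x y <= Rmax.

Definition return_ r pi (x : X) : \bar R := expect (pi x) (fun y => (r x y)%:E).

Definition rm_error2 pref rhat r (x : X) : \bar R :=
  expect (pref x) (fun y => ((rhat x y - r x y) ^+ 2)%:E).

Definition rm_error pref rhat r (x : X) : R :=
  Num.sqrt (fine (rm_error2 pref rhat r x)).

(* In \bar R, 0^-1 = +oo and 0 * +oo = 0: the coverage is +oo when pi x charges
   a response that pref x does not, and responses outside the support of pi x
   do not contribute. *)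
Definition coverage pref pi (x : X) : \bar R :=
  expect (pi x) (fun y => (pi x y)%:E / (pref x y)%:E)%E.

Definition relu (z : R) : R := Num.max z 0.

Definition pes_weight rhat (beta : R) (x : X) (lambda : R) (y : Y) : R :=
  relu (beta^-1 * (rhat x y - lambda)).

(* The solution exists and is unique as soon as 0 < N = size ys and 0 < beta. *)
Definition lambda_hat rhat (N : nat) (beta : R) (x : X) (ys : seq Y) : R :=
  xget 0 [set l | N%:R^-1 * \sum_(y <- ys) pes_weight rhat beta x l y = 1].

(* Returns the first accepted proposal, and ylast if there is none. *)
Fixpoint rejection (acc : Y -> R) (ys : seq Y) (ylast : Y) : distr R Y :=
  if ys is y :: ys' then
    bind (bernoulli_distr (acc y))
      (fun xi => if xi then ret y else rejection acc ys' ylast)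
  else ret ylast.

Definition inference_time_pessimism pref rhat (Rmax : R) (N : nat) (beta : R)
    : policy R X Y := fun x =>
  bind (iid N (pref x)) (fun ys =>
    let lambda := lambda_hat rhat N beta x ys in
    let M := (Rmax - lambda) / beta in
    let w := pes_weight rhat beta x lambda in
    bind (iid N (pref x)) (fun ys' => bind (pref x) (fun ylast =>
      rejection (fun y => Num.min (w y / M) 1) ys' ylast))).

End alignment.

(* Main.v *)
Require Import Defs.
From mathcomp Require Import all_boot all_order all_algebra.
From mathcomp Require Import all_classical all_reals all_analysis.
From mathcomp Require Import ring lra.

Set Implicit Arguments.
Unset Strict Implicit.
Unset Printing Implicit Defensive.

Import Order.TTheory GRing.Theory Num.Theory.
Import numFieldNormedType.Exports.
Local Open Scope classical_set_scope.
Local Open Scope ring_scope.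

(* Let u = pistar / pref, let w be the truncated weight at level l, m its mean
   under pref and v = w / m. The density v maximizes mean(rhat) - (m beta / 2) chi^2,
   and this objective is m beta-strongly concave; Young's inequality
   (u - v)(rstar - rhat) <= m beta (u - v)^2 / 2 + (rstar - rhat)^2 / (2 m beta)
   is absorbed by the strong concavity, whence
     J(pistar) - J(v pref) <= m beta C / 2 + eps^2 / (2 m beta).
   So it suffices that the empirical level gives 1/4 <= m <= 4. By monotonicity
   in l this can only fail if the empirical mean of w at one of the two fixed
   levels where the true mean is 1/4 or 4 lies on the wrong side of 1, which has
   probability exponentially small in N beta / Rmax, and so has the event that
   all proposals are rejected. The case beta > Rmax is trivial since C >= 1. *)

(** * Linearity, monotonicity and composition of expectations of nonnegative functions *)

Section expectation.
Context {R : realType} {S T : choiceType}.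
Implicit Types (p : distr R T) (f g : T -> \bar R).
Local Open Scope ereal_scope.

Lemma expect_ge0 p f : (forall t, 0 <= f t) -> 0 <= expect p f.
Proof. by move=> f0; apply: esum_ge0 => t _; rewrite mule_ge0// lee_fin Defs.pmf_ge0. Qed.

Lemma le_expect p f g : (forall t, f t <= g t) -> expect p f <= expect p g.
Proof.
move=> fg; apply: le_esum => t _.
by apply: lee_wpmul2l => //; rewrite lee_fin Defs.pmf_ge0.
Qed.

Lemma eq_expect p f g : f =1 g -> expect p f = expect p g.
Proof. by move=> fg; apply: eq_esum => t _; rewrite fg. Qed.

Lemma expectD p f g : (forall t, 0 <= f t) -> (forall t, 0 <= g t) ->
  expect p (fun t => f t + g t) = expect p f + expect p g.
Proof.
move=> f0 g0; rewrite /expect -esumD => [|t _|t _].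
- by apply: eq_esum => t _; rewrite ge0_muleDr.
- by rewrite mule_ge0// lee_fin Defs.pmf_ge0.
- by rewrite mule_ge0// lee_fin Defs.pmf_ge0.
Qed.

Lemma expectZl p (c : R) f : (0 <= c)%R -> (forall t, 0 <= f t) ->
  expect p (fun t => c%:E * f t) = c%:E * expect p f.
Proof.
move=> c0 f0; rewrite /expect -esumZl//; last first.
  by move=> t; rewrite mule_ge0// lee_fin Defs.pmf_ge0.
by apply: eq_esum => t _; rewrite muleCA.
Qed.

Lemma expect_cst p (c : R) : (0 <= c)%R -> expect p (fun=> c%:E) = c%:E.
Proof.
move=> c0; rewrite /expect; under eq_esum do rewrite muleC.
by rewrite esumZl ?Defs.pmf_sum1 ?mule1// => t; rewrite lee_fin Defs.pmf_ge0.
Qed.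

Lemma expect_ret (t : T) f : (forall t, 0 <= f t) -> expect (ret t) f = f t.
Proof.
move=> f0; rewrite /expect (esumID [set t]) => [|u _]; last first.
  by rewrite mule_ge0// lee_fin Defs.pmf_ge0.
rewrite setTI esum_set1; last by rewrite mule_ge0// lee_fin Defs.pmf_ge0.
rewrite /= eqxx mul1e setTI esum1 ?adde0//.
by move=> u /= /eqP/negPf ->; rewrite mul0e.
Qed.

Lemma expect_bind (p : distr R S) (k : S -> distr R T) f :
  (forall t, 0 <= f t) ->
  expect (bind p k) f = expect p (fun s => expect (k s) f).
Proof.
move=> f0; rewrite /expect.
have k0 s t : 0 <= (k s t)%:E * f t by rewrite mule_ge0// lee_fin Defs.pmf_ge0.
transitivity (\esum_(t in [set: T]) \esum_(s in [set: S])
    ((p s)%:E * ((k s t)%:E * f t))).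
  apply: eq_esum => t _; rewrite bindE.
  under [RHS]eq_esum do rewrite muleA -EFinM muleC.
  (* [esumZl] takes only a real factor, so an infinite value of [f] is treated apart: both sides are
     then [0] or [+oo], according to whether [t] has mass zero. *)
  have [->|] := eqVneq (f t) +oo.
    have pk0 s : 0 <= (p s * k s t)%:E by rewrite lee_fin mulr_ge0 ?Defs.pmf_ge0.
    have [z|/existsNP[s /eqP ps0]] := pselect (forall s, (p s * k s t)%R = 0%R).
      rewrite !esum1 ?mul0e// => s _; rewrite z ?mule0//.
    have ps : (0 < (p s * k s t)%R%:E) by rewrite lt0e ps0 pk0.
    rewrite gt0_muley; last first.
      apply: (lt_le_trans ps); apply: esum_ge; exists [set s] => //.
      by rewrite fsbig_set1.
    apply/esym/eqP; rewrite eq_le leey/=.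
    apply: esum_ge; exists [set s] => //; rewrite fsbig_set1 mulyr gtr0_sg//.
    by rewrite mul1e.
  move=> fty; have ftE : f t = (fine (f t))%:E.
    by rewrite fineK// ge0_fin_numE// ltey.
  by rewrite ftE muleC -esumZl// ?fine_ge0// => s; rewrite lee_fin mulr_ge0 ?Defs.pmf_ge0.
rewrite esum_exchange; last first.
  by move=> t s; rewrite mule_ge0// lee_fin Defs.pmf_ge0.
by apply: eq_esum => s _; rewrite esumZl ?Defs.pmf_ge0.
Qed.

End expectation.

(** * Bernoulli trials and i.i.d. samples *)

Section products.
Context {R : realType} {T : choiceType}.
Implicit Types (p : distr R T) (f g : seq T -> \bar R).
Local Open Scope ereal_scope.

Lemma expect_bernoulli (a : R) (f : bool -> \bar R) : (0 <= a <= 1)%R ->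
  (forall b, 0 <= f b) ->
  expect (bernoulli_distr a) f = a%:E * f true + (1 - a)%:E * f false.
Proof.
move=> a01 f0; rewrite /bernoulli_distr.
move: (boolP _); case: {-}_ / => [h|]; last by rewrite a01.
have g0 b : 0 <= (coin h b)%:E * f b.
  by rewrite mule_ge0// lee_fin Defs.pmf_ge0.
rewrite /expect (esumID [set true]); last by move=> b _; exact: g0.
rewrite setTI esum_set1//; congr (_ + _).
rewrite (_ : _ `&` _ = [set false]) ?esum_set1//.
by apply/seteqP; split => -[]//= [].
Qed.

Lemma expect_iidS n p f : (forall ys, 0 <= f ys) ->
  expect (iid n.+1 p) f = expect p (fun y => expect (iid n p) (fun ys => f (y :: ys))).
Proof.
move=> f0; rewrite /= expect_bind//; apply: eq_expect => y.
rewrite expect_bind//; apply: eq_expect => ys; exact: expect_ret.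
Qed.

(** An i.i.d. sample of length [n] is carried by lists of size [n]. The restriction matters because
    the defining equation of the empirical level is solvable only for lists of the right size. *)
Lemma le_expect_iid n p f g : (forall ys, 0 <= f ys) -> (forall ys, 0 <= g ys) ->
  (forall ys, size ys = n -> f ys <= g ys) ->
  expect (iid n p) f <= expect (iid n p) g.
Proof.
elim: n f g => [|n IH] f g f0 g0 fg.
  by rewrite /= !expect_ret// fg.
rewrite !expect_iidS//; apply: le_expect => y.
by apply: IH => // ys sz; apply: fg; rewrite /= sz.
Qed.

(** By independence the exponential of the sum factors, and each draw contributes a factor at most
    [m]; this is the moment bound behind both Chernoff estimates. *)
Lemma expect_iid_expR n p (g : T -> R) (m : R) :
  expect p (fun y => (expR (g y))%:E) <= m%:E ->
  expect (iid n p) (fun ys => (expR (\sum_(y <- ys) g y))%:E) <= (m ^+ n)%:E.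
Proof.
move=> gm.
have m0 : (0 <= m)%R.
  by rewrite -lee_fin (le_trans _ gm)// expect_ge0// => y; rewrite lee_fin expR_ge0.
elim: n => [|n IH].
  by rewrite /= expect_ret ?big_nil ?expR0// => ys; rewrite lee_fin expR_ge0.
rewrite expect_iidS => [|ys]; last by rewrite lee_fin expR_ge0.
have e0 (h : T -> R) y : 0 <= (expR (h y))%:E by rewrite lee_fin expR_ge0.
apply: (@le_trans _ _ (expect p (fun y => (m ^+ n)%:E * (expR (g y))%:E))).
  apply: le_expect => y.
  under eq_expect do rewrite big_cons expRD EFinM.
  rewrite expectZl ?expR_ge0//.
  by rewrite [leRHS]muleC; apply: lee_wpmul2l; rewrite ?lee_fin ?expR_ge0.
rewrite expectZl ?exprn_ge0// exprSr EFinM.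
by apply: lee_wpmul2l => //; rewrite lee_fin exprn_ge0.
Qed.

End products.

(** * Real-valued means and an intermediate value theorem *)

Section bounded_mean.
Context {R : realType} {T : choiceType}.
Implicit Types (p : distr R T) (f g : T -> R).

(** [fine] sends an infinite value to [0]; for bounded nonnegative [f], [meanE] shows that nothing
    is lost. *)
Definition mean p f : R := fine (expect p (fun t => (f t)%:E)).

Lemma meanE p f (K : R) : (forall t, 0 <= f t <= K) ->
  expect p (fun t => (f t)%:E) = (mean p f)%:E.
Proof.
move=> fK; rewrite /mean fineK// ge0_fin_numE; last first.
  by apply: expect_ge0 => t; rewrite lee_fin; case/andP: (fK t).
apply: (@le_lt_trans _ _ (expect p (fun=> `|K|%:E))).
  apply: le_expect => t; rewrite lee_fin; case/andP: (fK t) => _ h.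
  exact: le_trans h (ler_norm _).
by rewrite expect_cst// ltry.
Qed.

Lemma mean_ge0 p f : (forall t, 0 <= f t) -> 0 <= mean p f.
Proof. by move=> f0; rewrite fine_ge0// expect_ge0. Qed.

Lemma ivt_lipschitz (F : R -> R) (k a b v : R) :
  0 <= k -> (forall s t, F s <= F t + k * `|s - t|) ->
  a <= b -> F b <= v <= F a -> exists2 c, a <= c <= b & F c = v.
Proof.
move=> k0 Fk ab /andP[Fbv vFa].
have cF : continuous F.
  move=> s; apply/cvgrPdist_le => e e0; near=> t.
  have st : k * `|s - t| <= e.
    (* Dividing by [k + 1] instead of [k] covers the case [k = 0]. *)
    have h : `|s - t| <= e / (k + 1).
      near: t; apply: cvgr_dist_le; first exact: cvg_id.
      by rewrite divr_gt0// ltr_wpDl.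
    apply: (@le_trans _ _ ((k + 1) * (e / (k + 1)))).
      by apply: ler_pM => //; lra.
    by rewrite mulrC divfK// gt_eqF// ltr_wpDl.
  rewrite ler_norml; have := Fk s t; have := Fk t s; rewrite (distrC t s); lra.
have [||c cab Fc] := @IVT R F a b v ab; last by exists c.
  exact: continuous_subspaceT.
by rewrite ge_min le_max Fbv vFa orbT.
Unshelve. all: by end_near.
Qed.

End bounded_mean.

(** * Truncated linear weights and their regret as densities *)

Section truncation.
Context {R : realType} {T : choiceType}.
Implicit Types (p q : distr R T) (h : T -> R).

Lemma relu_ge0 (z : R) : 0 <= relu z.
Proof. by rewrite /relu le_max lexx orbT. Qed.

Lemma le_relu (z : R) : z <= relu z.
Proof. by rewrite /relu le_max lexx. Qed.

Lemma relu_le (z t : R) : 0 <= t -> z <= t -> relu z <= t.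
Proof. by move=> t0 zt; rewrite /relu ge_max zt. Qed.

Lemma relu_mull (a z : R) : 0 <= a -> relu (a * z) = a * relu z.
Proof. by move=> a0; rewrite /relu maxr_pMr// mulr0. Qed.

(* [pes_weight rhat b x] unfolds to [weight b (rhat x)]. *)
Definition weight (b : R) h (l : R) (t : T) : R := relu (b^-1 * (h t - l)).

Lemma weight_lipschitz b h s l t : 0 < b ->
  weight b h s t <= weight b h l t + b^-1 * `|s - l|.
Proof.
move=> b0; have bi : 0 <= b^-1 by rewrite invr_ge0 ltW.
apply: relu_le; first by rewrite addr_ge0 ?relu_ge0// mulr_ge0.
rewrite -[leLHS](_ : b^-1 * (h t - l) + b^-1 * (l - s) = _); last by ring.
by rewrite lerD ?le_relu// ler_wpM2l// distrC ler_norm.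
Qed.

Lemma weight_anti b h s l t : 0 < b -> s <= l -> weight b h l t <= weight b h s t.
Proof.
move=> b0 sl; apply: relu_le; first exact: relu_ge0.
by apply: le_trans (le_relu _); rewrite ler_wpM2l ?invr_ge0 ?(ltW b0)//; lra.
Qed.

Lemma weight_ge b h l t : (b^-1 * (h t - l)) <= weight b h l t.
Proof. exact: le_relu. Qed.

Lemma weight_le b h (Rmax l : R) t : 0 < b -> h t <= Rmax -> l <= Rmax ->
  weight b h l t <= (Rmax - l) / b.
Proof.
move=> b0 hR lR; apply: relu_le; first by rewrite divr_ge0 ?(ltW b0)//; lra.
by rewrite mulrC ler_wpM2r ?invr_ge0 ?(ltW b0)//; lra.
Qed.

Lemma weight_bounded b h (Rmax l : R) t : 0 < b -> 0 <= h t <= Rmax ->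
  0 <= weight b h l t <= b^-1 * (Rmax + `|l|).
Proof.
move=> b0 /andP[h0 hR]; rewrite relu_ge0/=; have bi := ltW b0.
have lN := ler_norm (- l); rewrite normrN in lN.
apply: relu_le; first by rewrite mulr_ge0 ?invr_ge0 ?addr_ge0// (le_trans h0).
by rewrite ler_wpM2l ?invr_ge0//; lra.
Qed.

(** The mean weight is Lipschitz in the level with constant [b^-1]. It vanishes at [Rmax], and at
    [- (t * b)] it is at least [t] because [h] is nonnegative; the intermediate value theorem
    applies in between. *)
Lemma exists_mean_weight p b h (Rmax t : R) : 0 < b -> 0 <= Rmax ->
  (forall y, 0 <= h y <= Rmax) -> 0 <= t ->
  exists2 l, - (t * b) <= l <= Rmax &
    expect p (fun y => (weight b h l y)%:E) = t%:E.
Proof.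
move=> b0 R0 hR t0; have bi : 0 <= b^-1 by rewrite invr_ge0 ltW.
have wE l := meanE p (fun y => weight_bounded l b0 (hR y)).
have [||||l lR lt] := @ivt_lipschitz R (fun l => mean p (weight b h l)) b^-1
    (- (t * b)) Rmax t => //.
- move=> s l; rewrite -lee_fin EFinD -!wE.
  have c0 : 0 <= b^-1 * `|s - l| by rewrite mulr_ge0.
  rewrite -(expect_cst p c0) -expectD.
  + by apply: le_expect => y; rewrite -EFinD lee_fin weight_lipschitz.
  + by move=> y; rewrite lee_fin relu_ge0.
  + by move=> y; rewrite lee_fin.
- by rewrite (@le_trans _ _ 0)// oppr_le0 mulr_ge0// ltW.
- apply/andP; split; rewrite -lee_fin -wE.
  + apply: (@le_trans _ _ (expect p (fun=> 0%:E))); last by rewrite expect_cst.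
    apply: le_expect => y; rewrite lee_fin (le_trans (@weight_le _ _ Rmax _ _ _ _ _))//.
      by case/andP: (hR y).
    by rewrite subrr mul0r.
  + rewrite -(expect_cst p t0); apply: le_expect => y; rewrite lee_fin.
    apply: le_trans (weight_ge _ _ _ _); rewrite mulrC ler_pdivlMr//.
    by case/andP: (hR y) => ? _; lra.
- by exists l => //; rewrite wE lt.
Qed.

(** A weight of mean 1 is a density [v] with respect to [p]. With [u = q / p], the integrand
    [(u - v) * (r - l)] splits into a model error, handled by Young's inequality, and
    [(u - v) * (h - l)], handled by the optimality of [v]. *)
Lemma weight_regret p q (r h : T -> R) (b l : R) : 0 < b -> (forall t, 0 <= r t) ->
  expect p (fun t => (weight b h l t)%:E) = 1%E ->
  (expect q (fun t => (r t)%:E) <=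
   expect p (fun t => (weight b h l t * r t)%:E)
   + (b / 2)%:E * expect q (fun t => (q t)%:E / (p t)%:E)
   + (2 * b)^-1%:E * expect p (fun t => ((h t - r t) ^+ 2)%:E))%E.
Proof.
move=> b0 r0 w1; pose K := `|l|.
have K0 : 0 <= K := normr_ge0 _.
have lK : l <= K := ler_norm _.
have NlK : - l <= K by rewrite /K -normrN ler_norm.
have Kl1 : 0 <= K - l by lra.
have Kl2 : 0 <= K + l by lra.
pose v := weight b h l; have v0 t : 0 <= v t := relu_ge0 _.
have cov0 t : (0 <= (q t)%:E / (p t)%:E)%E.
  by rewrite mule_ge0 ?inve_ge0// lee_fin Defs.pmf_ge0.
have b2 : 0 <= b / 2 by lra.
have bi2 : 0 <= (2 * b)^-1 by rewrite invr_ge0; lra.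
have e1 t : (0 <= (r t)%:E + (K - l)%:E)%E by rewrite adde_ge0 ?lee_fin.
have e2 t : (0 <= (K + l)%:E * (v t)%:E)%E by rewrite mule_ge0 ?lee_fin.
have e3 t : (0 <= K%:E * (v t)%:E)%E by rewrite mule_ge0 ?lee_fin.
have e4 t : (0 <= (2 * b)^-1%:E * ((h t - r t) ^+ 2)%:E)%E.
  by rewrite mule_ge0 ?lee_fin ?sqr_ge0.
have e5 t : (0 <= (v t * r t)%:E)%E by rewrite lee_fin mulr_ge0.
have e6 t : (0 <= (b / 2)%:E * ((q t)%:E / (p t)%:E))%E by rewrite mule_ge0 ?lee_fin.
have e7 t : (0 <= K%:E * (v t)%:E + (2 * b)^-1%:E * ((h t - r t) ^+ 2)%:E)%E.
  exact: adde_ge0.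
have e8 t : (0 <= (v t * r t)%:E + (K%:E * (v t)%:E
    + (2 * b)^-1%:E * ((h t - r t) ^+ 2)%:E))%E by exact: adde_ge0.
have e9 t : (0 <= K%:E + (b / 2)%:E * ((q t)%:E / (p t)%:E))%E.
  by rewrite adde_ge0 ?lee_fin.
(* [esum] cannot sum signed terms: the pointwise inequality is integrated after
   adding [K] times both densities, and [K] is cancelled at the end. *)
have key : (expect q (fun t => (r t)%:E + (K - l)%:E)
    + expect p (fun t => (K + l)%:E * (v t)%:E) <=
  expect p (fun t => (v t * r t)%:E + (K%:E * (v t)%:E
    + (2 * b)^-1%:E * ((h t - r t) ^+ 2)%:E))
  + expect q (fun t => K%:E + (b / 2)%:E * ((q t)%:E / (p t)%:E)))%E.
  have m0 (m : distr R T) (f : T -> \bar R) : (forall t, 0 <= f t)%E ->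
      forall t, [set: T] t -> (0 <= (m t)%:E * f t)%E.
    by move=> f0 t _; rewrite mule_ge0 ?lee_fin ?Defs.pmf_ge0.
  rewrite /expect -esumD; [|exact: m0|exact: m0].
  rewrite -esumD; [|exact: m0|exact: m0].
  apply: le_esum => t _.
  (* Off the support of [p] either [q t] also vanishes and both sides are zero, or the density
     ratio, hence the right-hand side, is [+oo]. *)
  have [pt0|pt0] := eqVneq (p t) 0.
    have [qt0|qt0] := eqVneq (q t) 0; first by rewrite pt0 qt0 !mul0e.
    have qt : 0 < q t by rewrite lt0r qt0 Defs.pmf_ge0.
    rewrite pt0 inve0 [((q t)%:E * +oo)%E]gt0_muley ?lte_fin//.
    rewrite [((b / 2)%:E * +oo)%E]gt0_muley ?lte_fin; last by lra.
    by rewrite addey// gt0_muley ?lte_fin// addey// leey.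
  have pt : 0 < p t by rewrite lt0r pt0 Defs.pmf_ge0.
  rewrite inver (negbTE pt0) -!EFinM -!EFinD lee_fin.
  set u := q t / p t; have u0 : 0 <= u by rewrite divr_ge0 ?Defs.pmf_ge0.
  have -> : q t = p t * u by rewrite /u mulrC divfK.
  clearbody u.
  rewrite -!mulrA -!mulrDr ler_pM2l//.
  suff : (u - v t) * (r t - l) <= b / 2 * (u * u) + (2 * b)^-1 * (h t - r t) ^+ 2 by lra.
  have young : (u - v t) * (r t - h t) <=
      b / 2 * (u - v t) ^+ 2 + (2 * b)^-1 * (h t - r t) ^+ 2.
    rewrite -subr_ge0.
    rewrite (_ : _ - _ = (2 * b)^-1 * (b * (u - v t) - (r t - h t)) ^+ 2).
      by rewrite mulr_ge0 ?sqr_ge0.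
    by field; lra.
  (* First-order condition for [v]: [h - l <= b * v] everywhere, with equality where [v] is
     positive. *)
  have opt : (u - v t) * (h t - l) <= b * (u * v t - v t * v t).
    have hl : h t - l <= b * v t.
      by rewrite -ler_pdivrMl// weight_ge.
    have vv : v t * (h t - l) = b * (v t * v t).
      rewrite /v /weight /relu /Num.max; case: ifP => [|_]; first by rewrite !mul0r mulr0.
      by field; rewrite gt_eqF.
    rewrite mulrBl vv [leRHS]mulrBr lerD2r mulrCA ler_wpM2l//.
  (* The quadratic terms of [young] and [opt] add up to [b / 2] times the difference of the squares
     of [u] and [v]; the square of [v] is dropped. *)
  have := mulr_ge0 b2 (sqr_ge0 (v t)).
  have -> : (u - v t) * (r t - l) = (u - v t) * (r t - h t) + (u - v t) * (h t - l) by ring.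
  move: young opt; rewrite !expr2; lra.
move: key.
rewrite !expectD//; try by move=> t; rewrite lee_fin.
rewrite !expectZl//; try by move=> t; rewrite lee_fin ?sqr_ge0.
rewrite w1 !expect_cst// !mule1 -addeA -EFinD.
set A := expect q _; set B := expect p _; set C := expect q _; set D := expect p _.
rewrite (_ : (K - l + (K + l))%R = (K + K)%R); last by ring.
rewrite (_ : (B + _ + _ = B + (b / 2)%:E * C + (2 * b)^-1%:E * D + (K + K)%:E)%E).
  by rewrite leeD2rE.
rewrite EFinD -!addeA; congr (_ + _)%E.
by rewrite addeA addeACA [LHS]addeC [(_ * D + _)%E]addeC -addeA.
Qed.

End truncation.

(** * Chernoff bounds for bounded variables *)

Section concentration.
Context {R : realType} {T : choiceType}.
Implicit Types (p : distr R T) (w : T -> R).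

(** Without signed expectations, the means of [w] and [1 - w] are added and the finite [m] is
    cancelled. *)
Lemma expect_compl p w (m : R) : (forall t, 0 <= w t <= 1) ->
  expect p (fun t => (w t)%:E) = m%:E ->
  expect p (fun t => (1 - w t)%:E) = (1 - m)%:E.
Proof.
move=> w01 wm.
have w0 t : (0 <= (w t)%:E)%E by rewrite lee_fin; case/andP: (w01 t).
have w1 t : (0 <= (1 - w t)%:E)%E by rewrite lee_fin subr_ge0; case/andP: (w01 t).
have := expectD p w1 w0; rewrite wm.
under eq_expect do rewrite -EFinD subrK.
by rewrite expect_cst// EFinB => ->; rewrite addeK.
Qed.

(** This bound and the next one follow from [1 + y <= expR y] by taking inverses. *)
Lemma expR_le_1D2 (x : R) : 0 <= x <= 2^-1 -> expR x <= 1 + 2 * x.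
Proof.
move=> /andP[x0 x2]; rewrite -[x]opprK expRN opprK.
rewrite -[leRHS]invrK lef_pV2 ?posrE ?expR_gt0 ?invr_gt0//; last by lra.
apply: le_trans (expR_ge1Dx _).
by rewrite -[leLHS]mul1r ler_pdivrMr; nra.
Qed.

Lemma expRN_le_1B (x : R) : 0 <= x <= 1 -> expR (- x) <= 1 - x / 2.
Proof.
move=> /andP[x0 x1]; rewrite expRN -[leRHS]invrK.
rewrite lef_pV2 ?posrE ?expR_gt0 ?invr_gt0//; last by lra.
apply: le_trans (expR_ge1Dx _).
by rewrite -[leLHS]mul1r ler_pdivrMr; nra.
Qed.

(** The rate [(2 * M)^-1] keeps the scaled variable below 1/2, where [expR] lies under the chord
    [1 + 2 * x]. The resulting exponent is negative once [m < 1/2]. *)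
Lemma chernoff_upper n p w (M m : R) : 0 < M -> (forall t, 0 <= w t <= M) ->
  expect p (fun t => (w t)%:E) = m%:E ->
  (expect (iid n p) (fun ys => (expR (\sum_(y <- ys) (w y - 1) / (2 * M)))%:E)
   <= (expR (n%:R * ((2 * m - 1) / (2 * M))))%:E)%E.
Proof.
move=> M0 wM wm; rewrite expRM_natl; apply: expect_iid_expR.
have Mi : 0 <= M^-1 by rewrite invr_ge0 ltW.
pose c := expR (- (2 * M)^-1).
have w0 t : 0 <= w t by case/andP: (wM t).
apply: (@le_trans _ _ (expect p (fun t => c%:E * (1%:E + (M^-1)%:E * (w t)%:E))%E)).
  apply: le_expect => t; rewrite -(EFinM M^-1) -EFinD -EFinM lee_fin.
  rewrite (_ : _ / _ = - (2 * M)^-1 + w t / (2 * M)); last by ring.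
  rewrite expRD ler_wpM2l ?expR_ge0//.
  apply: le_trans (expR_le_1D2 _) _.
    rewrite divr_ge0//=; last by lra.
    rewrite ler_pdivrMr; last by lra.
    by case/andP: (wM t) => ? ?; lra.
  by rewrite le_eqVlt (_ : _ == _)//; apply/eqP; field; lra.
rewrite expectZl ?expR_ge0//; last by move=> t; rewrite adde_ge0 ?mule_ge0 ?lee_fin.
rewrite expectD//; last by move=> t; rewrite mule_ge0 ?lee_fin.
rewrite expectZl// expect_cst// wm -(EFinM M^-1) -EFinD -EFinM lee_fin.
apply: (@le_trans _ _ (c * expR (M^-1 * m))).
  by rewrite ler_wpM2l ?expR_ge0// expR_ge1Dx.
rewrite -expRD ler_expR le_eqVlt (_ : _ == _)//; apply/eqP; field; lra.
Qed.

(** Here the rate [M^-1] suffices, since [expRN_le_1B] is valid up to 1. The exponent is negative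
    once [m > 2]. *)
Lemma chernoff_lower n p w (M m : R) : 0 < M -> (forall t, 0 <= w t <= M) ->
  expect p (fun t => (w t)%:E) = m%:E ->
  (expect (iid n p) (fun ys => (expR (\sum_(y <- ys) (1 - w y) / M))%:E)
   <= (expR (n%:R * ((1 - m / 2) / M)))%:E)%E.
Proof.
move=> M0 wM wm; rewrite expRM_natl; apply: expect_iid_expR.
have Mi : 0 <= (2 * M)^-1 by rewrite invr_ge0; lra.
pose c := expR M^-1.
have w0 t : 0 <= w t by case/andP: (wM t).
have wb t : 0 <= (2 * M)^-1 * w t <= 1.
  rewrite mulr_ge0//= mulrC ler_pdivrMr; last by lra.
  by case/andP: (wM t) => ? ?; lra.
apply: (@le_trans _ _ (expect p (fun t => c%:E * (1 - (2 * M)^-1 * w t)%:E)%E)).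
  apply: le_expect => t; rewrite -EFinM lee_fin.
  rewrite (_ : _ / _ = M^-1 + - (w t / M)); last by ring.
  rewrite expRD ler_wpM2l ?expR_ge0//.
  apply: le_trans (expRN_le_1B _) _.
    rewrite divr_ge0//=; last by lra.
    rewrite ler_pdivrMr; last by lra.
    by case/andP: (wM t) => ? ?; lra.
  by rewrite le_eqVlt (_ : _ == _)//; apply/eqP; field; lra.
rewrite expectZl ?expR_ge0//; last first.
  by move=> t; rewrite lee_fin subr_ge0; case/andP: (wb t).
rewrite (@expect_compl _ _ ((2 * M)^-1 * m))//; last first.
  by under eq_expect do rewrite EFinM; rewrite expectZl// wm.
rewrite -EFinM lee_fin.
apply: (@le_trans _ _ (c * expR (- ((2 * M)^-1 * m)))).
  by rewrite ler_wpM2l ?expR_ge0// expR_ge1Dx.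
rewrite -expRD ler_expR le_eqVlt (_ : _ == _)//; apply/eqP; field; lra.
Qed.

End concentration.

(** * Rejection sampling at a fixed level *)

Section rejection_sampling.
Context {R : realType} {T : choiceType}.
Implicit Types (p q : distr R T) (r h acc : T -> R).

(** The conditional expected reward given the first batch of samples, which enters only through
    [acc]. *)
Definition rejection_return n p acc r : \bar R :=
  expect (iid n p) (fun ys => expect p (fun ylast =>
    expect (rejection acc ys ylast) (fun y => (r y)%:E))).

(* [J] stands for the mean of [r] under the law proportional to [acc * p], which
   is the law of the output conditionally on some proposal being accepted. *)
Lemma rejection_return_ge n p acc r (A J : R) :
  (forall t, 0 <= acc t <= 1) -> (forall t, 0 <= r t) ->
  expect p (fun t => (acc t)%:E) = A%:E ->
  expect p (fun t => (acc t * r t)%:E) = (J * A)%:E -> 0 <= J -> 0 <= A <= 1 ->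
  ((J * (1 - (1 - A) ^+ n))%:E <= rejection_return n p acc r)%E.
Proof.
move=> acc01 r0 accA accr J0 /andP[A0 A1].
have rE (d : distr R T) : (0 <= expect d (fun y => (r y)%:E))%E.
  by apply: expect_ge0 => t; rewrite lee_fin.
elim: n => [|n IH].
  (* With no proposal the bound is 0: the reward of the fallback response is simply discarded. *)
  rewrite expr0 subrr mulr0; apply: expect_ge0 => ys.
  by apply: expect_ge0 => yl; exact: rE.
set H := J * _ in IH.
have H0 : 0 <= H.
  by rewrite mulr_ge0// subr_ge0 exprn_ile1// ?subr_ge0//; lra.
have a0 t : 0 <= acc t by case/andP: (acc01 t).
have a1 t : 0 <= 1 - acc t by rewrite subr_ge0; case/andP: (acc01 t).
rewrite /rejection_return expect_iidS; last first.
  by move=> ys; apply: expect_ge0 => yl; exact: rE.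
(* The bound satisfies the recursion of the sampler: accepting the first proposal contributes
   [J * A], rejecting it leaves [(1 - A) * H]. *)
have -> : (J * (1 - (1 - A) ^+ n.+1))%:E =
    expect p (fun t => (acc t * r t)%:E + H%:E * (1 - acc t)%:E)%E.
  rewrite expectD => [|t|t]; last 2 first.
  - by rewrite lee_fin mulr_ge0.
  - by rewrite mule_ge0 ?lee_fin.
  rewrite accr expectZl// (expect_compl acc01 accA) -(EFinM H) -EFinD.
  by congr _%:E; rewrite /H exprS; ring.
apply: le_expect => y.
have E1 ys yl : expect (rejection acc (y :: ys) yl) (fun y => (r y)%:E) =
    ((acc y * r y)%:E + (1 - acc y)%:E * expect (rejection acc ys yl) (fun y => (r y)%:E))%E.
  rewrite /= expect_bind => [|t]; last by rewrite lee_fin.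
  rewrite expect_bernoulli// ?expect_ret// => -[]; exact: rE.
under eq_expect => ys do under eq_expect => yl do rewrite E1.
have c0 (ys : seq T) (yl : T) : (0 <= (1 - acc y)%:E * expect (rejection acc ys yl) (fun y => (r y)%:E))%E.
  by rewrite mule_ge0 ?lee_fin.
have b0 : (0 <= (acc y * r y)%:E)%E by rewrite lee_fin mulr_ge0.
under eq_expect => ys do rewrite expectD// expect_cst ?mulr_ge0// expectZl//.
have d0 ys : (0 <= expect p (fun yl => expect (rejection acc ys yl) (fun y => (r y)%:E)))%E.
  exact: expect_ge0.
rewrite expectD//; last by move=> ys; rewrite mule_ge0 ?lee_fin.
rewrite expect_cst ?mulr_ge0// expectZl//.
by apply: leeD => //; rewrite muleC; apply: lee_wpmul2l => //; rewrite lee_fin.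
Qed.

(** Dividing the weight by its mean [m] amounts to replacing [b] by [b * m], so [weight_regret]
    applies at [b * m]; the range of [m] turns its constants into [2 * b] and [2 / b]. The
    exponential term pays for the rejection of all proposals. *)
Lemma regret_of_typical_lambda n p q r h (Rmax b l m : R) :
  0 < b <= Rmax -> (forall t, 0 <= r t <= Rmax) -> (forall t, 0 <= h t <= Rmax) ->
  - b <= l <= Rmax - b -> 4^-1 <= m <= 4 ->
  expect p (fun t => (weight b h l t)%:E) = m%:E ->
  (expect q (fun t => (r t)%:E) <=
   rejection_return n p (fun y => Num.min (weight b h l y / ((Rmax - l) / b)) 1)%R r
   + ((2 * b)%:E * expect q (fun t => (q t)%:E / (p t)%:E)
   + (2 / b)%:E * expect p (fun t => ((h t - r t) ^+ 2)%:E)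
   + (Rmax * expR (- (n%:R * (b / (20 * Rmax)))))%:E))%E.
Proof.
move=> /andP[b0 bR] rR hR /andP[bl lR] /andP[m1 m4] wm.
have m0 : 0 < m by lra.
have R0 : 0 < Rmax by lra.
have bm : 0 < b * m by exact: mulr_gt0.
have r0 t : 0 <= r t by case/andP: (rR t).
have vE t : weight (b * m) h l t = m^-1 * weight b h l t.
  rewrite /weight invfM [_ / m]mulrC -mulrA relu_mull//.
  by rewrite invr_ge0 ltW.
have w0 t : 0 <= weight b h l t by exact: relu_ge0.
have mi : 0 <= m^-1 by rewrite invr_ge0 ltW.
have v1 : expect p (fun t => (weight (b * m) h l t)%:E) = 1%E.
  under eq_expect do rewrite vE EFinM.
  by rewrite expectZl// ?wm -?EFinM ?mulVf ?gt_eqF// => t; rewrite lee_fin.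
set M := (Rmax - l) / b.
have M1 : 1 <= M by rewrite /M ler_pdivlMr//; lra.
have M0 : 0 < M by lra.
have wM t : weight b h l t <= M.
  by apply: weight_le => //; [case/andP: (hR t)|lra].
(* The cap at 1 is never active, as [M] dominates the weight. *)
have accE t : Num.min (weight b h l t / M) 1 = M^-1 * weight b h l t.
  by rewrite mulrC; apply/min_idPl; rewrite mulrC ler_pdivrMr ?mul1r.
pose v t := weight (b * m) h l t.
have v0 t : 0 <= v t by exact: relu_ge0.
pose J := mean p (fun t => v t * r t).
have JE : expect p (fun t => (v t * r t)%:E) = J%:E.
  apply: (@meanE _ _ _ _ (m^-1 * M * Rmax)) => t; rewrite mulr_ge0//=.
  by apply: ler_pM => //; [rewrite /v vE ler_wpM2l|case/andP: (rR t)].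
have J0 : 0 <= J by apply: mean_ge0 => t; exact: mulr_ge0.
have JR : J <= Rmax.
  rewrite -lee_fin -JE -[leRHS]mule1 -v1 -expectZl; [|exact: ltW|by move=> t; rewrite lee_fin].
  apply: le_expect => t; rewrite -EFinM lee_fin mulrC ler_wpM2r//.
  by case/andP: (rR t).
pose A := m / M.
have accA : expect p (fun t => (Num.min (weight b h l t / M) 1)%:E) = A%:E.
  under eq_expect do rewrite accE EFinM.
  rewrite expectZl ?invr_ge0 ?(ltW M0)//.
  by rewrite wm -EFinM mulrC.
have A01 : 0 <= A <= 1.
  rewrite divr_ge0 ?(ltW m0) ?(ltW M0)//= -lee_fin -accA -[leRHS](expect_cst p ler01).
  by apply: le_expect => t; rewrite lee_fin ge_min lexx orbT.
have accr : expect p (fun t => (Num.min (weight b h l t / M) 1 * r t)%:E) = (J * A)%:E.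
  have e t : (Num.min (weight b h l t / M) 1 * r t)%:E = (A%:E * (v t * r t)%:E)%E.
    by rewrite accE -EFinM /v vE /A; congr _%:E; field; rewrite !gt_eqF.
  under eq_expect do rewrite e.
  rewrite expectZl; [by rewrite JE -EFinM mulrC|by case/andP: A01|].
  by move=> t; rewrite lee_fin mulr_ge0.
have /= G := @rejection_return_ge n p _ r A J _ r0 accA accr J0 A01.
apply: le_trans (weight_regret q bm r0 v1) _.
rewrite -/v JE.
(* All proposals are rejected with probability [(1 - A) ^ n <= exp (- n A)]. *)
have rest : J <= J * (1 - (1 - A) ^+ n) + Rmax * expR (- (n%:R * (b / (20 * Rmax)))).
  have : J * (1 - A) ^+ n <= Rmax * expR (- (n%:R * (b / (20 * Rmax)))).
    case/andP: A01 => A0 A1.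
    apply: ler_pM => //; first by rewrite exprn_ge0// subr_ge0.
    apply: (@le_trans _ _ (expR (- A) ^+ n)).
      by rewrite lerXn2r ?nnegrE ?expR_ge0 ?subr_ge0// expR_ge1Dx.
    rewrite -expRM_natl ler_expR mulrN lerN2 ler_wpM2l//.
    rewrite /A /M ler_pdivlMr; last by rewrite divr_gt0//; lra.
    rewrite (_ : b / (20 * Rmax) * ((Rmax - l) / b) = (Rmax - l) / (20 * Rmax)); last first.
      by field; rewrite !gt_eqF.
    (* From [- b <= l] and [b <= Rmax], [Rmax - l <= 2 * Rmax], so the quotient is at most 1/10,
       below [m]. *)
    by rewrite ler_pdivrMr; nra.
  by lra.
have b2 : b * m / 2 <= 2 * b by nra.
have b3 : (2 * (b * m))^-1 <= 2 / b.
  rewrite -[leRHS]invrK lef_pV2 ?posrE ?invr_gt0 ?divr_gt0//; last by lra.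
  by rewrite invf_div; nra.
have cov0 : (0 <= expect q (fun t => (q t)%:E / (p t)%:E))%E.
  by apply: expect_ge0 => t; rewrite mule_ge0 ?inve_ge0// lee_fin Defs.pmf_ge0.
have e0 : (0 <= expect p (fun t => ((h t - r t) ^+ 2)%:E))%E.
  by apply: expect_ge0 => t; rewrite lee_fin sqr_ge0.
set X := (_ * expect q _)%E; set Y := (_ * expect p _)%E.
set X' := (_ * expect q _)%E; set Y' := (_ * expect p _)%E.
have XX : (X <= X')%E by apply: lee_wpmul2r => //; rewrite lee_fin.
have YY : (Y <= Y')%E by apply: lee_wpmul2r => //; rewrite lee_fin.
apply: (@le_trans _ _ ((J * (1 - (1 - A) ^+ n))%:E
    + (X' + Y' + (Rmax * expR (- (n%:R * (b / (20 * Rmax)))))%:E))%E); last first.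
  apply: leeD => //; apply: G => t; rewrite accE -accE le_min ler01 ge_min lexx orbT !andbT.
  by rewrite divr_ge0 ?w0// ltW.
rewrite [(X' + Y' + _)%E]addeC addeA -EFinD addeA.
by apply: leeD => //; apply: leeD => //; rewrite lee_fin.
Qed.

End rejection_sampling.

(** * The empirical level and the regret of the full algorithm *)

Section pessimism.
Context {R : realType} {X : Type} {Y : choiceType}.
Implicit Types (rhat : X -> Y -> R) (ys : seq Y).

Lemma average_le ys N (f g : Y -> R) (c : R) : (0 < N)%N -> size ys = N ->
  (forall y, f y <= g y + c) ->
  N%:R^-1 * \sum_(y <- ys) f y <= N%:R^-1 * (\sum_(y <- ys) g y) + c.
Proof.
move=> N0 sz fgc.
have Nc : c = N%:R^-1 * \sum_(y <- ys) c.
  rewrite big_const_seq count_predT iter_addr_0 sz -[c *+ _]mulr_natl mulKf//.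
  by rewrite pnatr_eq0 -lt0n.
rewrite [in leRHS]Nc -mulrDr -big_split/= ler_wpM2l ?invr_ge0//.
by apply: ler_sum => y _; exact: fgc.
Qed.

(** The empirical mean weight is Lipschitz in the level, at least 1 at [- b] and at most 0 at
    [Rmax], so [xget] picks a genuine solution. The bounds on [l] come from comparing the value 1 at
    [l] with [- l / b] and [(Rmax - l) / b]. *)
Lemma lambda_hatP rhat N (b Rmax : R) x ys : 0 < b -> 0 <= Rmax ->
  (forall y, 0 <= rhat x y <= Rmax) -> (0 < N)%N -> size ys = N ->
  let l := lambda_hat rhat N b x ys in
  \sum_(y <- ys) weight b (rhat x) l y = N%:R /\ - b <= l <= Rmax - b.
Proof.
move=> b0 R0 hR N0 sz l.
have bi : 0 <= b^-1 by rewrite invr_ge0 ltW.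
pose F (s : R) := N%:R^-1 * \sum_(y <- ys) weight b (rhat x) s y.
have avg0 (c : R) : N%:R^-1 * (\sum_(y <- ys) (0 : R)) + c = c.
  by rewrite big1_eq mulr0 add0r.
have F_le (s c : R) : (forall y, weight b (rhat x) s y <= c) -> F s <= c.
  move=> wc; rewrite -[leRHS]avg0; apply: average_le => // y.
  by rewrite add0r.
have F_ge (s c : R) : (forall y, c <= weight b (rhat x) s y) -> c <= F s.
  move=> wc; rewrite -subr_ge0.
  rewrite -[leLHS](_ : N%:R^-1 * (\sum_(y <- ys) (0 : R)) = _); last first.
    by rewrite big1_eq mulr0.
  by apply: average_le => // y; rewrite subr_ge0.
have Fl : F l = 1.
  apply: (@xgetPex _ 0 [set s | F s = 1]).
  have [||||c _ Fc] := @ivt_lipschitz R F b^-1 (- b) Rmax 1 => //.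
  - by move=> s t; apply: average_le => // y; exact: weight_lipschitz.
  - by lra.
  - apply/andP; split.
    + apply: F_le => y; apply: le_trans (@weight_le _ _ _ _ Rmax _ y b0 _ _) _ => //.
        by case/andP: (hR y).
      by rewrite subrr mul0r.
    + apply: F_ge => y; apply: le_trans (weight_ge _ _ _ _).
      rewrite mulrC ler_pdivlMr//; case/andP: (hR y) => ? _; lra.
  - by exists c.
split.
  by rewrite -[RHS]mulr1 -[X in _ = _ * X]Fl mulVKf// pnatr_eq0 -lt0n.
apply/andP; split.
  have : - l / b <= F l.
    apply: F_ge => y; apply: le_trans (weight_ge _ _ _ _).
    rewrite mulrC ler_wpM2l//; case/andP: (hR y) => ? _; lra.
  by rewrite Fl ler_pdivrMr//; lra.
(* Above [Rmax] every weight vanishes, which contradicts an average of 1. *)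
have [lR|Rl] := leP l Rmax.
  have : F l <= (Rmax - l) / b.
    by apply: F_le => y; apply: weight_le => //; case/andP: (hR y).
  by rewrite Fl ler_pdivlMr//; lra.
have : F l <= 0.
  apply: F_le => y; apply: relu_le => //.
  by rewrite mulr_ge0_le0//; case/andP: (hR y) => _ ?; lra.
by rewrite Fl ler10.
Qed.

(** Conditioning on the first batch, the regret is that of a typical level unless one of two
    deviations occurs. The factor 3 counts these two events and the rejection of all proposals. *)
Lemma pessimism_regret (pref pistar : policy R X Y) (rstar rhat : X -> Y -> R)
    (Rmax b : R) N x :
  0 < b <= Rmax -> (forall y, 0 <= rstar x y <= Rmax) ->
  (forall y, 0 <= rhat x y <= Rmax) -> (0 < N)%N ->
  (coverage pref pistar x < +oo)%E -> (rm_error2 pref rhat rstar x < +oo)%E ->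
  (return_ rstar pistar x <=
   return_ rstar (inference_time_pessimism pref rhat Rmax N b) x
   + ((2 * b)%:E * coverage pref pistar x + (2 / b)%:E * rm_error2 pref rhat rstar x
   + (3 * (Rmax * expR (- (N%:R * (b / (20 * Rmax))))))%:E))%E.
Proof.
move=> bR rR hR N0 Cfin Efin; have /andP[b0 bR'] := bR.
have R0 : 0 < Rmax by lra.
have r0 y : (0 <= (rstar x y)%:E)%E by rewrite lee_fin; case/andP: (rR y).
have rE (d : distr R Y) : (0 <= expect d (fun y => (rstar x y)%:E))%E.
  exact: expect_ge0.
(* Unlike the empirical level, [l1] and [l4] are deterministic, so the weights at these levels are
   i.i.d. over the sample. *)
have [l1 /andP[l1a l1b] w1] := @exists_mean_weight _ _ (pref x) b (rhat x) Rmax 4^-1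
  b0 (ltW R0) hR ltac:(lra).
have [l4 /andP[l4a l4b] w4] := @exists_mean_weight _ _ (pref x) b (rhat x) Rmax 4
  b0 (ltW R0) hR ltac:(lra).
(* Both levels are at least [- (4 * b)] and [b <= Rmax], whence the 5. The Chernoff exponents per
   draw are then [- b / (20 * Rmax)] at mean 1/4 and four times that at mean 4. *)
pose M := 5 * Rmax / b.
have M0 : 0 < M by rewrite divr_gt0//; lra.
have wM l y : - (4 * b) <= l -> l <= Rmax -> 0 <= weight b (rhat x) l y <= M.
  move=> l4' lR; rewrite relu_ge0/=.
  apply: le_trans (@weight_le _ _ _ _ Rmax _ y b0 _ lR) _.
    by case/andP: (hR y).
  by rewrite ler_wpM2r ?invr_ge0 ?(ltW b0)//; lra.
pose e := expR (- (N%:R * (b / (20 * Rmax)))).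
have e0 : 0 <= e by exact: expR_ge0.
pose U ys := expR (\sum_(y <- ys) (weight b (rhat x) l1 y - 1) / (2 * M)).
pose L ys := expR (\sum_(y <- ys) (1 - weight b (rhat x) l4 y) / M).
have U0 ys : (0 <= (U ys)%:E)%E by rewrite lee_fin expR_ge0.
have L0 ys : (0 <= (L ys)%:E)%E by rewrite lee_fin expR_ge0.
have Ue : (expect (iid N (pref x)) (fun ys => (U ys)%:E) <= e%:E)%E.
  apply: le_trans (@chernoff_upper _ _ N (pref x) _ M 4^-1 M0 _ w1) _.
    by move=> y; apply: wM => //; lra.
  rewrite lee_fin ler_expR le_eqVlt (_ : _ == _)//; apply/eqP.
  by rewrite /M; field; rewrite !gt_eqF.
have Le : (expect (iid N (pref x)) (fun ys => (L ys)%:E) <= e%:E)%E.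
  apply: le_trans (@chernoff_lower _ _ N (pref x) _ M 4 M0 _ w4) _.
    by move=> y; apply: wM => //; lra.
  rewrite lee_fin ler_expR -[leRHS]mulrN ler_wpM2l// /M.
  rewrite (_ : (1 - 4 / 2) / _ = - (4 * (b / (20 * Rmax)))); last first.
    by field; rewrite !gt_eqF.
  have : 0 <= b / (20 * Rmax) by rewrite divr_ge0//; lra.
  by lra.
set C := coverage pref pistar x; set E2 := rm_error2 pref rhat rstar x.
have C0 : (0 <= C)%E.
  by apply: expect_ge0 => t; rewrite mule_ge0 ?inve_ge0// lee_fin Defs.pmf_ge0.
have E0 : (0 <= E2)%E by apply: expect_ge0 => t; rewrite lee_fin sqr_ge0.
pose D := ((2 * b)%:E * C + (2 / b)%:E * E2 + (Rmax * e)%:E)%E.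
have D0 : (0 <= D)%E.
  by rewrite !adde_ge0 ?mule_ge0 ?lee_fin ?mulr_ge0 ?invr_ge0//; lra.
pose J := mean (pistar x) (rstar x).
have JE : return_ rstar pistar x = J%:E := meanE (pistar x) rR.
have J0 : 0 <= J by apply: mean_ge0 => y; rewrite -lee_fin.
have JR : J <= Rmax.
  rewrite -lee_fin -JE -(expect_cst (pistar x) (ltW R0)).
  by apply: le_expect => y; rewrite lee_fin; case/andP: (rR y).
pose G ys := rejection_return N (pref x) (fun y => Num.min
   (weight b (rhat x) (lambda_hat rhat N b x ys) y
    / ((Rmax - lambda_hat rhat N b x ys) / b)) 1) (rstar x).
have G0 ys : (0 <= G ys)%E.
  by apply: expect_ge0 => ys'; apply: expect_ge0 => yl; exact: rE.
have -> : return_ rstar (inference_time_pessimism pref rhat Rmax N b) x =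
    expect (iid N (pref x)) G.
  rewrite /return_ /inference_time_pessimism expect_bind//.
  apply: eq_expect => ys; rewrite expect_bind//; apply: eq_expect => ys'.
  by rewrite expect_bind.
have RU0 ys : (0 <= Rmax%:E * (U ys)%:E)%E by rewrite mule_ge0// lee_fin ltW.
have RL0 ys : (0 <= Rmax%:E * (L ys)%:E)%E by rewrite mule_ge0// lee_fin ltW.
have DE : D = (fine D)%:E.
  rewrite fineK// ge0_fin_numE// /D.
  rewrite -(@fineK _ C) ?ge0_fin_numE// -(@fineK _ E2) ?ge0_fin_numE//.
  by rewrite -!EFinM -!EFinD ltry.
have d0 : 0 <= fine D by exact: fine_ge0.
(* The indicators of the two deviation events are bounded by the exponentials
   [U] and [L] of Chernoff's method. *)
have pointwise ys : size ys = N ->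
    (J%:E <= G ys + ((fine D)%:E + (Rmax%:E * (U ys)%:E + Rmax%:E * (L ys)%:E)))%E.
  move=> sz; have [] := @lambda_hatP rhat N b Rmax x ys b0 (ltW R0) hR N0 sz.
  set l := lambda_hat rhat N b x ys => sumw lb.
  have [m mE] : exists m, expect (pref x) (fun y => (weight b (rhat x) l y)%:E) = m%:E.
    by eexists; exact: (meanE (pref x) (fun y => weight_bounded l b0 (hR y))).
  have mono s t : s <= t -> (expect (pref x) (fun y => (weight b (rhat x) t y)%:E) <=
      expect (pref x) (fun y => (weight b (rhat x) s y)%:E))%E.
    by move=> st; apply: le_expect => y; rewrite lee_fin weight_anti.
  have JUL : 1 <= U ys \/ 1 <= L ys -> (J%:E <= Rmax%:E * (U ys)%:E + Rmax%:E * (L ys)%:E)%E.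
    have h1 : 0 <= U ys by exact: expR_ge0.
    have h2 : 0 <= L ys by exact: expR_ge0.
    move: (U ys) (L ys) h1 h2 => u v h1 h2 uv; rewrite -!EFinM -EFinD lee_fin.
    apply: (le_trans JR); rewrite -mulrDr ler_peMr ?(ltW R0)//.
    by case: uv; lra.
  have rest : 1 <= U ys \/ 1 <= L ys -> (J%:E <= G ys +
      ((fine D)%:E + (Rmax%:E * (U ys)%:E + Rmax%:E * (L ys)%:E)))%E.
    move=> /JUL h; apply: (le_trans h); rewrite addeA leeDr// adde_ge0//.
  (* A mean below 1/4 forces [l1 <= l], so the weights at [l1] dominate those at [l], which sum to
     [N]; the exponent in [U ys] is therefore nonnegative. The case [4 < m] is symmetric, with
     [l <= l4] and [L]. *)
  have [ml|ml] := ltP m 4^-1.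
    apply: rest; left; rewrite -[leLHS]expR0 ler_expR -mulr_suml divr_ge0//; last by lra.
    rewrite sumrB -[X in _ - X](_ : N%:R = _); last first.
      by rewrite big_const_seq count_predT iter_addr_0 sz.
    rewrite -sumw subr_ge0; apply: ler_sum => y _; apply: weight_anti => //.
    have [//|ll] := leP l1 l.
    by have := mono _ _ (ltW ll); rewrite mE w1 lee_fin leNgt ml.
  have [m4|m4] := ltP 4 m.
    apply: rest; right; rewrite -[leLHS]expR0 ler_expR -mulr_suml divr_ge0//; last by lra.
    rewrite sumrB -[X in X - _](_ : N%:R = _); last first.
      by rewrite big_const_seq count_predT iter_addr_0 sz.
    rewrite -sumw subr_ge0; apply: ler_sum => y _; apply: weight_anti => //.
    have [//|ll] := leP l l4.
    by have := mono _ _ (ltW ll); rewrite mE w4 lee_fin leNgt m4.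
  have m14 : 4^-1 <= m <= 4 by rewrite ml m4.
  have := @regret_of_typical_lambda _ _ N (pref x) (pistar x) (rstar x) (rhat x)
    Rmax b l m bR rR hR lb m14 mE.
  rewrite (meanE (pistar x) rR) -/J -/(G ys) => /le_trans; apply.
  rewrite -DE; apply: leeD => //; rewrite leeDl// adde_ge0//.
rewrite -(expect_cst (iid N (pref x)) J0) in JE.
rewrite JE; apply: (@le_trans _ _ _ _ _ (le_expect_iid (pref x) _ _ pointwise)).
- by move=> ys; rewrite lee_fin.
- by move=> ys; rewrite !adde_ge0.
rewrite expectD//; last by move=> ys; rewrite !adde_ge0.
apply: leeD => //.
rewrite expectD//; last by move=> ys; rewrite !adde_ge0.
rewrite expectD// expect_cst// !expectZl ?(ltW R0)// -DE.
have -> : ((2 * b)%:E * C + (2 / b)%:E * E2 + (3 * (Rmax * e))%:E)%E =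
   (D + (Rmax%:E * e%:E + Rmax%:E * e%:E))%E.
  rewrite /D -[RHS]addeA -!EFinM -!EFinD; congr (_ + _%:E)%E; ring.
by apply: leeD => //; apply: leeD; apply: lee_wpmul2l => //; rewrite lee_fin ltW.
Qed.

End pessimism.

(** * Choice of the sample size and final bounds *)

Section guarantees.
Context {R : realType} {X : Type} {Y : choiceType}.
Implicit Types (pref pistar : policy R X Y) (rstar rhat : X -> Y -> R).

(** Sum the inequality [2 q <= q^2 / p + p], which is [(q - p)^2 / p >= 0]; [p] is added on the
    right to keep all terms nonnegative. *)
Lemma coverage_ge1 pref pistar x : (1 <= coverage pref pistar x)%E.
Proof.
set p := pref x; set q := pistar x.
have cov0 t : (0 <= (q t)%:E / (p t)%:E)%E.
  by rewrite mule_ge0 ?inve_ge0// lee_fin Defs.pmf_ge0.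
have : (expect q (fun=> 2%:E) <= coverage pref pistar x + expect p (fun=> 1%:E))%E.
  rewrite /coverage -/p -/q /expect -esumD => [|t _|t _]; last 2 first.
  - by rewrite mule_ge0// lee_fin Defs.pmf_ge0.
  - by rewrite mule_ge0 ?lee_fin ?Defs.pmf_ge0.
  apply: le_esum => t _.
  have [pt0|pt0] := eqVneq (p t) 0.
    have [->|qt0] := eqVneq (q t) 0; first by rewrite !mul0e add0e pt0 mul0e.
    have qt : 0 < q t by rewrite lt0r qt0 Defs.pmf_ge0.
    by rewrite pt0 inve0 !gt0_muley ?lte_fin// mul0e adde0 leey.
  have pt : 0 < p t by rewrite lt0r pt0 Defs.pmf_ge0.
  rewrite inver (negbTE pt0) -!EFinM -!EFinD lee_fin -subr_ge0.
  rewrite (_ : _ - _ = (q t - p t) ^+ 2 / p t); last by field.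
  by rewrite divr_ge0 ?sqr_ge0// ltW.
by rewrite !expect_cst// (_ : 2%:E = (1 + 1)%:E :> \bar R)// EFinD leeD2rE.
Qed.

Lemma pessimism_regret_N pref pistar rstar rhat (Rmax b C e2 : R) N x :
  1 <= Rmax -> bounded_reward Rmax rstar -> bounded_reward Rmax rhat ->
  0 < b -> 0 < e2 <= 1 -> (0 < N)%N ->
  coverage pref pistar x = C%:E -> rm_error2 pref rhat rstar x = e2%:E ->
  20 * (Rmax / b) * ln (Rmax / (b * Num.sqrt e2)) <= N%:R ->
  (return_ rstar pistar x
   - return_ rstar (inference_time_pessimism pref rhat Rmax N b) x
   <= (5 * b * C + 2 / b * e2)%:E)%E.
Proof.
move=> R1 rR hR b0 /andP[e20 e21] N0 CE eE NE.
have R0 : 0 < Rmax by lra.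
have C1 : 1 <= C by rewrite -lee_fin -CE coverage_ge1.
have bC : b <= b * C by rewrite ler_peMr// ltW.
have be : 0 <= 2 / b * e2 by rewrite mulr_ge0 ?divr_ge0// ltW.
have JE pi : return_ rstar pi x = (mean (pi x) (rstar x))%:E := meanE (pi x) (rR x).
have J0 pi : 0 <= mean (pi x) (rstar x).
  by apply: mean_ge0 => y; case/andP: (rR x y).
have [Rb|bR] := ltP Rmax b.
  rewrite !JE -EFinB lee_fin.
  have : mean (pistar x) (rstar x) <= Rmax.
    rewrite -lee_fin -JE -(expect_cst (pistar x) (ltW R0)).
    by apply: le_expect => y; rewrite lee_fin; case/andP: (rR x y).
  have := J0 (inference_time_pessimism pref rhat Rmax N b); lra.
rewrite leeBlDl ?JE// -JE.
have bR2 : 0 < b <= Rmax by rewrite b0.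
apply: le_trans (@pessimism_regret _ _ _ pref _ _ _ _ _ N x bR2 (rR x) (hR x) N0 _ _) _.
- by rewrite CE ltry.
- by rewrite eE ltry.
rewrite -JE; apply: leeD => //; rewrite CE eE -!EFinM -!EFinD lee_fin.
set s := Num.sqrt e2 in NE.
have s0 : 0 < s by rewrite sqrtr_gt0.
have s1 : s <= 1 by rewrite -sqrtr1 ler_sqrt.
have bs : 0 < b * s by exact: mulr_gt0.
(* Three such terms cost at most [3 * b <= 3 * b * C], which with [2 * b * C] gives the constant 5.
   The condition on [N] even bounds each by [b * s], and [s <= 1]. *)
suff : Rmax * expR (- (N%:R * (b / (20 * Rmax)))) <= b by lra.
have : ln (Rmax / (b * s)) <= N%:R * (b / (20 * Rmax)).
  rewrite -ler_pdivrMr ?divr_gt0 ?mulr_gt0//.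
  by apply: le_trans NE; rewrite le_eqVlt (_ : _ == _)//; apply/eqP; field; rewrite !gt_eqF.
rewrite -lerN2 -lnV ?posrE ?divr_gt0// -(ler_expR (- _)).
rewrite lnK ?posrE ?invr_gt0 ?divr_gt0//.
move=> /(ler_wpM2l (ltW R0)) /le_trans; apply.
rewrite (_ : Rmax * (Rmax / (b * s))^-1 = b * s); last first.
  by field; rewrite !gt_eqF.
by rewrite ler_piMr// ltW.
Qed.

End guarantees.

Theorem theorem4p1 (R : realType) :
  (exists c c' : R, 0 < c /\ 0 < c' /\
    forall (X : Type) (Y : choiceType) (pref : policy R X Y)
      (rstar rhat : X -> Y -> R) (Rmax : R),
    1 <= Rmax -> bounded_reward Rmax rstar -> bounded_reward Rmax rhat ->
    forall (x : X) (pistar : policy R X Y) (beta : R) (N : nat),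
    let eps2 := rm_error2 pref rhat rstar x in
    let eps := rm_error pref rhat rstar x in
    let C := coverage pref pistar x in
    let pes := inference_time_pessimism pref rhat Rmax N beta in
    0 < beta -> (0 < eps2 <= 1)%E -> (1 <= N)%N ->
    c * (Rmax / beta) * ln (Rmax / (beta * eps)) <= N%:R ->
    (return_ rstar pistar x - return_ rstar pes x <=
      c'%:E * (sqrte (C * eps2) + beta%:E * C + beta^-1%:E * eps2))%E)
  /\
  (forall a b : R, 0 < a -> a <= b ->
    exists (C0 c'' : R) (k : nat), 0 < C0 /\ 0 < c'' /\
    forall (X : Type) (Y : choiceType) (pref : policy R X Y)
      (rstar rhat : X -> Y -> R) (Rmax : R),
    1 <= Rmax -> bounded_reward Rmax rstar -> bounded_reward Rmax rhat ->
    forall (x : X) (pistar : policy R X Y) (beta : R) (N : nat),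
    let eps2 := rm_error2 pref rhat rstar x in
    let eps := rm_error pref rhat rstar x in
    let C := coverage pref pistar x in
    let pes := inference_time_pessimism pref rhat Rmax N beta in
    0 < beta -> (0 < eps2 <= 1)%E -> (1 <= N)%N -> (C < +oo)%E ->
    a * Num.sqrt (fine eps2 / fine C) <= beta ->
    beta <= b * Num.sqrt (fine eps2 / fine C) ->
    C0 * Num.sqrt (Rmax ^+ 2 * fine C / fine eps2)
       * (1 + ln (Rmax * fine C / eps)) ^+ k <= N%:R ->
    (return_ rstar pistar x - return_ rstar pes x <=
      c''%:E * sqrte (C * eps2))%E).
Proof.
split.
  exists 20, 5; do 2 (split; first by []).
  move=> X Y pref rstar rhat Rmax R1 rR hR x pistar b N; cbv zeta.
  move=> b0 /andP[e0 e1] N0 NE.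
  have eE : rm_error2 pref rhat rstar x = (fine (rm_error2 pref rhat rstar x))%:E.
    by rewrite fineK// ge0_fin_numE ?ltW// (le_lt_trans e1)// ltry.
  set e2 := fine _ in eE.
  have e2b : 0 < e2 <= 1 by rewrite -lte_fin -lee_fin -eE e0.
  have [e20 _] := andP e2b.
  have C1 := coverage_ge1 pref pistar x.
  rewrite eE; case CE : (coverage pref pistar x) C1 => [C| |]// C1.
    apply: le_trans (pessimism_regret_N R1 rR hR b0 e2b N0 CE eE NE) _.
    rewrite lee_fin in C1.
    rewrite -(EFinM C) -(EFinM b) -(EFinM b^-1) [sqrte _]/= -!EFinD -EFinM lee_fin.
    have s0 : 0 <= Num.sqrt (C * e2) := sqrtr_ge0 _.
    have : 0 <= b^-1 * e2 by rewrite mulr_ge0 ?invr_ge0// ltW.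
    lra.
  (* With infinite coverage the right-hand side is [+oo]. *)
  rewrite gt0_mulye ?lte_fin// [sqrte _]/= gt0_muley ?lte_fin// !addye// gt0_muley ?lte_fin//.
  by rewrite leey.
move=> a b a0 ab; have b0 : 0 < b by lra.
have ai : 0 < a^-1 by rewrite invr_gt0.
(* The division by [a] comes from bounding [Rmax / beta], and [2 + a^-1] from bounding the
   logarithm. In [5 * b + 2 / a] the terms bound [5 * beta * C] and [2 / beta * e2]. One power of
   the logarithm suffices. *)
exists (20 * (2 + a^-1) / a), (5 * b + 2 / a), 1%N.
split; first by rewrite divr_gt0// mulr_gt0//; lra.
split; first by lra.
move=> X Y pref rstar rhat Rmax R1 rR hR x pistar beta N; cbv zeta.
move=> beta0 /andP[e0 e1] N0 Cfin.
have eE : rm_error2 pref rhat rstar x = (fine (rm_error2 pref rhat rstar x))%:E.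
  by rewrite fineK// ge0_fin_numE ?ltW// (le_lt_trans e1)// ltry.
rewrite /rm_error; set e2 := fine _ in eE *.
have e2b : 0 < e2 <= 1 by rewrite -lte_fin -lee_fin -eE e0.
have [e20 e21] := andP e2b.
have C1 := coverage_ge1 pref pistar x.
rewrite eE; case CE : (coverage pref pistar x) C1 Cfin => [C| |]// C1 _.
have R0 : 0 < Rmax by lra.
rewrite lee_fin in C1; rewrite expr1 [fine C%:E]/=.
have C0 : 0 < C by lra.
set s := Num.sqrt e2; set k := Num.sqrt C.
have s0 : 0 < s by rewrite sqrtr_gt0.
have k1 : 1 <= k by rewrite -[leLHS]sqrtr1 ler_sqrt//; lra.
have k0 : 0 < k by lra.
have s1 : s <= 1 by rewrite -sqrtr1 ler_sqrt.
have ss : s * s = e2 by rewrite -expr2 sqr_sqrtr// ltW.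
have kk : k * k = C by rewrite -expr2 sqr_sqrtr// ltW.
have -> : Num.sqrt (e2 / C) = s / k by rewrite sqrtrM ?(ltW e20)// sqrtrV// ltW.
have -> : Num.sqrt (Rmax ^+ 2 * C / e2) = Rmax * k / s.
  rewrite sqrtrM ?(mulr_ge0 (sqr_ge0 _) (ltW C0))// sqrtrV ?(ltW e20)//.
  by rewrite sqrtrM ?sqr_ge0// sqrtr_sqr ger0_norm// ltW.
move=> abeta bbeta NE.
have sk : Num.sqrt (C * e2) = s * k by rewrite sqrtrM ?(ltW C0)// mulrC.
apply: le_trans (pessimism_regret_N R1 rR hR beta0 e2b N0 CE eE _) _.
  apply: le_trans NE.
  have L0 : 0 <= ln (Rmax * C / s).
    by rewrite ln_ge0// ler_pdivlMr// mul1r; nra.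
  have RB : Rmax / beta <= Rmax * k / s / a.
    rewrite -!mulrA ler_pM2l// -[leRHS]invrK lef_pV2 ?posrE ?invr_gt0 ?divr_gt0 ?mulr_gt0 ?invr_gt0//.
    by apply: le_trans abeta; rewrite le_eqVlt (_ : _ == _)//; apply/eqP; field; rewrite !gt_eqF.
  have P1 : 0 < Rmax * C / s by rewrite divr_gt0// mulr_gt0.
  have P2 : 0 < Rmax / (beta * s) by rewrite divr_gt0// mulr_gt0.
  (* The argument is at most [a^-1 * (Rmax * C / s) ^+ 2]: the square yields the 2, and
     [ln a^-1 <= a^-1] the rest. *)
  have LB : ln (Rmax / (beta * s)) <= (2 + a^-1) * (1 + ln (Rmax * C / s)).
    apply: (@le_trans _ _ (ln (a^-1 * (Rmax * C / s) ^+ 2))).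
      rewrite ler_ln ?posrE//; last by rewrite mulr_gt0// exprn_gt0.
      rewrite invfM mulrA.
      apply: (@le_trans _ _ (Rmax * k / s / a / s)).
        by rewrite ler_pM2r ?invr_gt0.
      rewrite (_ : a^-1 * _ = (Rmax * C ^+ 2) * Rmax / s / a / s); last first.
        by field; rewrite !gt_eqF.
      have si : 0 < s^-1 by rewrite invr_gt0.
      rewrite !ler_pM2r//.
      rewrite -kk -[leLHS]mulr1 ler_pM ?mulr_ge0 ?(ltW R0) ?(ltW k0)//.
      rewrite ler_pM2l// expr2.
      have kk1 : 1 <= k * k by nra.
      by nra.
    rewrite [leLHS]lnM ?posrE ?exprn_gt0// lnXn//.
    have : ln a^-1 <= a^-1.
      by rewrite -ler_expR lnK ?posrE//; apply: le_trans (expR_ge1Dx _); lra.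
    rewrite -mulr_natl; have := mulr_ge0 (ltW ai) L0; lra.
  have RB0 : 0 < Rmax / beta by rewrite divr_gt0.
  apply: (@le_trans _ _ (20 * (Rmax / beta) * ((2 + a^-1) * (1 + ln (Rmax * C / s))))).
    by rewrite ler_pM2l// mulr_gt0.
  apply: (@le_trans _ _ (20 * (Rmax * k / s / a) * ((2 + a^-1) * (1 + ln (Rmax * C / s))))).
    by rewrite ler_wpM2r ?mulr_ge0 ?addr_ge0 ?(ltW ai)// ler_pM2l.
  by rewrite le_eqVlt (_ : _ == _)//; apply/eqP; ring.
rewrite -(EFinM C) [sqrte _]/= sk -EFinM lee_fin.
have h1 : beta * C <= b * (s * k).
  apply: le_trans (ler_wpM2r (ltW C0) bbeta) _.
  by rewrite -kk le_eqVlt (_ : _ == _)//; apply/eqP; field; rewrite gt_eqF.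
have h2 : e2 / beta <= s * k / a.
  rewrite ler_pdivrMr// -ss.
  apply: (@le_trans _ _ (s * k / a * (a * (s / k)))).
    by rewrite le_eqVlt (_ : _ == _)//; apply/eqP; field; rewrite !gt_eqF.
  by rewrite ler_wpM2l ?divr_ge0 ?mulr_ge0 ?(ltW s0) ?(ltW k0) ?(ltW a0).
lra.
Qed.
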